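(* For almost all $\theta\in\mathbb C$ (with respect to Lebesgue measure), for all $C<\frac{\sqrt2}{3-\sqrt3}$ and all $T\ge1$, there exists $Q\ge T$ such that the system \[0<|q|<Q,\qquad |q\theta-p|\le \frac{C}{Q}\] has no solution with $p,q\in\mathbb Z[i]$. *)

(* Defs.v *)
From mathcomp Require Import all_boot all_order all_algebra.
From mathcomp Require Import complex.
From mathcomp Require Import all_classical all_reals all_analysis.

Set Implicit Arguments.
Unset Strict Implicit.
Unset Printing Implicit Defensive.

Import Order.TTheory GRing.Theory Num.Theory.
Import numFieldNormedType.Exports.

Local Open Scope classical_set_scope.
Local Open Scope ring_scope.
Local Open Scope complex_scope.

Definition gaussian_int (R : realType) (z : R[i]) : Prop :=
  complex.Re z \is a Num.int /\ complex.Im z \is a Num.int.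

(* The library has no measure on R[i]: Lebesgue measure on the complex plane is
   the product measure on R * R, transported along (x, y) |-> x + iy. *)
Definition ae_complex (R : realType) (P : R[i] -> Prop) : Prop :=
  {ae (@lebesgue_measure R \x @lebesgue_measure R)%E,
    forall xy, P (xy.1 +i* xy.2)}.

(* Main.v *)
Require Import Defs.
From mathcomp Require Import all_boot all_order all_algebra.
From mathcomp Require Import complex.
From mathcomp Require Import all_classical all_reals all_analysis.
From mathcomp Require Import measurable_realfun.
From mathcomp Require Import ring lra zify.

(** Scaling by Q turns the system into the question whether the Z[i]-lattice
    generated by (1/Q, Q theta) and (0, Q) has a nonzero point in the bidisc
    |x| < 1, |y| <= C.  There is a critical lattice of covolume 1 avoiding
    |x| < 1, |y| < sqrt 2 / (3 - sqrt 3), and for smaller C all lattices close to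
    a rescaling of it still avoid the bidisc, so theta is good as soon as some
    basis of its lattice at a scale Q >= T is close to the critical basis.

    Near every convergent p/q of theta there is such a good disc of radius
    comparable to |q|^-2: prepend p/q to a fixed element of SL_2(Z[i]), chosen
    so that the ratio of the new denominators approximates the ratio of the
    first coordinates of the critical basis; the remaining coordinates are then
    adjusted by moving theta.  Since theta is within 3 |q|^-2 of p/q for
    infinitely many convergents, the set of bad irrational theta is porous with
    a uniform constant at arbitrarily small scales around each of its points,
    and a Vitali covering argument shows that it is null. *)

Set Implicit Arguments.
Unset Strict Implicit.
Unset Printing Implicit Defensive.

Import Order.TTheory GRing.Theory Num.Theory.
Import numFieldNormedType.Exports.

Local Open Scope classical_set_scope.
Local Open Scope ring_scope.
Local Open Scope complex_scope.

(** * Gaussian integers *)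

Notation cabs := Normc.normc.

(** * The modulus as a real-valued function *)

Section ComplexModulus.
Variable R : realType.
Implicit Types z w : R[i].

Lemma cabs_ge0 z : 0 <= cabs z.
Proof. by case: z => a b; exact: sqrtr_ge0. Qed.

Lemma cabs0 : cabs (0 : R[i]) = 0.
Proof. exact: Normc.normc0. Qed.

Lemma cabs1 : cabs (1 : R[i]) = 1.
Proof. exact: Normc.normc1. Qed.

Lemma cabsM z w : cabs (z * w) = cabs z * cabs w.
Proof. exact: Normc.normcM. Qed.

Lemma cabsV z : cabs z^-1 = (cabs z)^-1.
Proof. exact: Normc.normcV. Qed.

Lemma cabsN z : cabs (- z) = cabs z.
Proof. exact: normcN. Qed.

Lemma cabs_leD z w : cabs (z + w) <= cabs z + cabs w.
Proof. exact: le_normcD. Qed.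

Lemma cabs_leB z w : cabs (z - w) <= cabs z + cabs w.
Proof. by rewrite -(cabsN w) cabs_leD. Qed.

Lemma cabs_geB z w : cabs z - cabs w <= cabs (z - w).
Proof. by rewrite lerBlDr -{1}(subrK w z) cabs_leD. Qed.

Lemma cabs_distC z w : cabs (z - w) = cabs (w - z).
Proof. by rewrite -cabsN opprB. Qed.

Lemma cabs_eq0 z : (cabs z == 0) = (z == 0).
Proof.
by apply/eqP/eqP => [/Normc.eq0_normc//|->]; exact: cabs0.
Qed.

Lemma cabs_gt0 z : (0 < cabs z) = (z != 0).
Proof. by rewrite lt_def cabs_ge0 andbT cabs_eq0. Qed.

Lemma cabs_real (x : R) : cabs x%:C = `|x|.
Proof. by rewrite /= expr0n addr0 sqrtr_sqr. Qed.

Lemma sqr_cabs z : cabs z ^+ 2 = complex.Re z ^+ 2 + complex.Im z ^+ 2.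
Proof. by case: z => a b; rewrite sqr_sqrtr// addr_ge0 ?sqr_ge0. Qed.

Lemma cabs_geRe z : `|complex.Re z| <= cabs z.
Proof.
by rewrite -[leLHS]sqrtr_sqr; case: z => a b; rewrite ler_wsqrtr// lerDl sqr_ge0.
Qed.

Lemma cabs_geIm z : `|complex.Im z| <= cabs z.
Proof.
by rewrite -[leLHS]sqrtr_sqr; case: z => a b; rewrite ler_wsqrtr// lerDr sqr_ge0.
Qed.

Lemma cabs_leReIm z : cabs z <= `|complex.Re z| + `|complex.Im z|.
Proof.
rewrite -(ler_pXn2r (n := 2)) ?nnegrE ?cabs_ge0 ?addr_ge0//.
rewrite sqr_cabs sqrrD !real_normK ?num_real// addrAC lerDl.
by rewrite mulrn_wge0// mulr_ge0.
Qed.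

End ComplexModulus.

(** * The ring of Gaussian integers and rounding *)

Section GaussianIntegers.
Variable R : realType.
Implicit Types z w : R[i].

Lemma gaussian_intD z w :
  gaussian_int z -> gaussian_int w -> gaussian_int (z + w).
Proof.
by case: z w => [a b] [c d] [/= ? ?] [/= ? ?]; split; apply: rpredD.
Qed.

Lemma gaussian_intN z : gaussian_int z -> gaussian_int (- z).
Proof. by case: z => [a b] [/= ? ?]; split; rewrite /= rpredN. Qed.

Lemma gaussian_intB z w :
  gaussian_int z -> gaussian_int w -> gaussian_int (z - w).
Proof. by move=> gz gw; apply/gaussian_intD/gaussian_intN. Qed.

Lemma gaussian_intM z w :
  gaussian_int z -> gaussian_int w -> gaussian_int (z * w).
Proof.
case: z w => [a b] [c d] [/= ? ?] [/= ? ?].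
by split; rewrite /= ?rpredB ?rpredD// rpredM.
Qed.

Lemma gaussian_int_nat n : gaussian_int (n%:R : R[i]).
Proof.
have -> : (n%:R : R[i]) = (n%:R)%:C by rewrite rmorph_nat.
by split; rewrite /= ?rpred0 ?natr_int.
Qed.

Lemma gaussian_int0 : gaussian_int (0 : R[i]).
Proof. exact: (gaussian_int_nat 0). Qed.

Lemma gaussian_int1 : gaussian_int (1 : R[i]).
Proof. exact: (gaussian_int_nat 1). Qed.

(** Rounding both coordinates leaves a squared distance of at most 1/2, and 3/4 is a rational bound
    for its square root. Being below 1, it makes the continued fraction errors contract. *)
Lemma gaussian_int_round z :
  exists2 g, gaussian_int g & cabs (z - g) <= 3 / 4.
Proof.
have round (x : R) : exists2 n, n \is a Num.int & `|x - n| <= 1 / 2.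
  exists (Num.floor (x + 1 / 2))%:~R; first exact: intr_int.
  have := floor_itv (x + 1 / 2); rewrite intrD => /andP[h1 h2].
  by rewrite ler_norml; apply/andP; split; lra.
case: z => x y.
have [a ai xa] := round x; have [b bi yb] := round y.
exists (a +i* b) => //; rewrite -(ler_pXn2r (n := 2)) ?nnegrE ?cabs_ge0//.
rewrite sqr_cabs /=; move: xa yb; rewrite !ler_norml => /andP[? ?] /andP[? ?].
by nra.
Qed.

End GaussianIntegers.

(** * Continued fractions over the Gaussian integers *)

Section Convergents.
Variable R : realType.
Implicit Types (theta p q : R[i]) (H : R).

(* Continued fractions with a nearest Gaussian integer: the errors shrink by 3/4
   at each step, and the determinant condition gives
   |q''| |x| <= 1 + |q| |x''| <= 1 + (3/4)^2 |q| |x'|, whose fixed point is < 3. *)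
Lemma convergent_pairs theta (n : nat) :
  (forall p q, gaussian_int p -> gaussian_int q -> q != 0 ->
     q * theta - p != 0) ->
  exists p q p' q' : R[i],
    [/\ [/\ gaussian_int p, gaussian_int q, gaussian_int p' & gaussian_int q'],
        cabs (p * q' - p' * q) = 1,
        cabs (q' * theta - p') <= (3 / 4) ^+ n,
        cabs (q * theta - p) <= 3 / 4 * cabs (q' * theta - p') &
        cabs q * cabs (q' * theta - p') <= 3 /\
        cabs q' * cabs (q' * theta - p') <= 3].
Proof.
move=> irr; elim: n => [|n [p [q [p' [q' [[gp gq gp' gq'] det x'n xx' [qx' q'x']]]]]]].
  have [g gg gtheta] := gaussian_int_round theta.
  (* The pair before the first convergent is [p' = -1], [q' = 0], whose error is exactly 1. *)
  exists g, 1, (-1), 0.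
  have -> : g * 0 - -1 * 1 = 1 :> R[i] by ring.
  have -> : 0 * theta - -1 = 1 by ring.
  rewrite mul1r expr0 cabs0 cabs1; split=> //; try by [split; lra|lra].
  split=> //; [exact: gaussian_int1| |exact: gaussian_int0].
  exact/gaussian_intN/gaussian_int1.
pose x := q * theta - p; pose x' := q' * theta - p'.
rewrite -/x -/x' in x'n xx' qx' q'x' *.
(* Irrationality covers [q != 0]; if [q = 0], the determinant rules out [p = 0]. *)
have x0 : x != 0.
  have [q0|] := eqVneq q 0; last exact: irr.
  apply/eqP; rewrite /x q0 mul0r sub0r => /eqP; rewrite oppr_eq0 => /eqP p0.
  by move/eqP: det; rewrite q0 p0 mul0r mulr0 subr0 cabs0 eq_sym oner_eq0.
have [a ga wa] := gaussian_int_round (- x' / x).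
exists (a * p + p'), (a * q + q'), p, q.
have -> : (a * q + q') * theta - (a * p + p') = a * x + x' by rewrite /x /x'; ring.
have xx'' : cabs (a * x + x') <= 3 / 4 * cabs x.
  have -> : a * x + x' = - ((- x' / x - a) * x) by field.
  by rewrite cabsN cabsM ler_wpM2r ?cabs_ge0.
have q''x : cabs (a * q + q') * cabs x <= 3.
  rewrite -cabsM.
  have -> : (a * q + q') * x = q * (a * x + x') - (p * q' - p' * q).
    by rewrite /x /x'; ring.
  apply: (le_trans (cabs_leB _ _)); rewrite det cabsM.
  have := cabs_ge0 q; move: qx' xx' xx'' => h1 h2 h3.
  by have := cabs_ge0 x'; have := cabs_ge0 x; nra.
split => //.
- by split=> //; apply/gaussian_intD => //; apply/gaussian_intM.
- by rewrite -det cabs_distC; congr cabs; ring.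
- apply: (le_trans xx'); rewrite exprS; apply: ler_wpM2l => //; lra.
- split=> //; apply: le_trans qx'; apply: ler_wpM2l; first exact: cabs_ge0.
  by apply: (le_trans xx'); have := cabs_ge0 x'; lra.
Qed.

(** With errors [x] and [x'], the determinant condition reads 1 = |q x' - q' x|, so a tiny [x']
    makes |q| + |q'| large and one of the two denominators reaches [H]. The bound on [d] puts
    [d / q] in the unit disc, where [unimodular_ratio] is uniform. *)
Lemma dirichlet_unimodular theta H : 0 < H ->
  (forall p q, gaussian_int p -> gaussian_int q -> q != 0 ->
     q * theta - p != 0) ->
  exists p q b d : R[i],
    [/\ [/\ gaussian_int p, gaussian_int q, gaussian_int b & gaussian_int d],
        cabs (p * d - b * q) = 1, H <= cabs q, cabs d <= cabs q &
        cabs q * cabs (q * theta - p) <= 3].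
Proof.
move=> H0 irr.
have [n Hn] : exists n, (3 / 4 : R) ^+ n <= (2 * H)^-1.
  have /cvgr0Pnorm_le/(_ (2 * H)^-1) : GRing.exp (3 / 4 : R) n @[n --> \oo] --> 0.
    by apply: cvg_expr; rewrite ger0_norm; lra.
  rewrite invr_gt0 mulr_gt0// => /(_ isT) [n _ /(_ n (leqnn n)) /= h].
  by exists n; apply: le_trans h; exact: ler_norm.
(* Subtracting a multiple of [(p, q)] from [(b, d)] preserves the determinant and brings [d / q]
   into the disc of radius 3/4. *)
have reduce p q b d :
    gaussian_int p -> gaussian_int q -> gaussian_int b -> gaussian_int d ->
    cabs (p * d - b * q) = 1 -> H <= cabs q ->
    cabs q * cabs (q * theta - p) <= 3 ->
  exists p q b d : R[i],
    [/\ [/\ gaussian_int p, gaussian_int q, gaussian_int b & gaussian_int d],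
        cabs (p * d - b * q) = 1, H <= cabs q, cabs d <= cabs q &
        cabs q * cabs (q * theta - p) <= 3].
  move=> gp gq gb gd det Hq qx.
  have q0 : q != 0 by rewrite -cabs_gt0; lra.
  have [j gj dj] := gaussian_int_round (d / q).
  exists p, q, (b - j * p), (d - j * q); split => //.
  - by split=> //; apply/gaussian_intB => //; apply/gaussian_intM.
  - by rewrite -det; congr cabs; ring.
  - have -> : d - j * q = (d / q - j) * q by field.
    by rewrite cabsM; have := cabs_ge0 q; nra.
have [p [q [p' [q' [[gp gq gp' gq'] det x'n xx' [qx' q'x']]]]]] :=
  convergent_pairs n irr.
have qq' : 2 * H <= cabs q + cabs q'.
  have : 1 <= cabs (q' * theta - p') * (cabs q + cabs q').
    rewrite -det.
    have -> : p * q' - p' * q = q * (q' * theta - p') - q' * (q * theta - p) by ring.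
    apply: (le_trans (cabs_leB _ _)); rewrite !cabsM mulrDr [leRHS]addrC addrC.
    rewrite [leRHS]addrC; move: xx'.
    by have := cabs_ge0 q'; have := cabs_ge0 (q' * theta - p'); nra.
  move=> h1; have h2 : cabs (q' * theta - p') <= (2 * H)^-1 by exact: le_trans Hn.
  have : 1 <= (2 * H)^-1 * (cabs q + cabs q').
    by apply: (le_trans h1); apply: ler_wpM2r => //; rewrite addr_ge0 ?cabs_ge0.
  by rewrite ler_pdivlMl ?mulr_gt0// mulr1.
have [Hq|Hq] := leP H (cabs q).
  apply: (reduce p q p' q') => //; apply: le_trans qx'.
  apply: ler_wpM2l; first exact: cabs_ge0.
  by apply: (le_trans xx'); have := cabs_ge0 (q' * theta - p'); lra.
apply: (reduce p' q' p q) => //; last lra.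
by rewrite cabs_distC.
Qed.

End Convergents.

(** * Lattices close to a critical lattice *)

Section UnimodularRatio.
Variable R : realType.

(* The row (be, de) = (N^2, 1 + N m) is unimodular because
   (1 + N m) (1 - N m) + N^2 m^2 = 1, and de / be is close to m / N.  Adding a
   large multiple k of it to the other row makes both ratios (ga + de e) /
   (al + be e) and de / be nearly equal, uniformly in e. *)
Lemma unimodular_ratio (rho : R[i]) (eps L : R) : 0 < eps -> 0 < L ->
  exists (al be ga de : R[i]) (M : R),
    [/\ [/\ gaussian_int al, gaussian_int be, gaussian_int ga & gaussian_int de],
        al * de - be * ga = 1 &
        forall e, cabs e <= 1 ->
          [/\ L * (1 + cabs be) <= cabs (al + be * e), cabs (al + be * e) <= M &
              cabs ((ga + de * e) / (al + be * e) - rho) <= eps]].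
Proof.
move=> eps0 L0.
pose N := Num.bound (4 / eps).
have Neps : 4 / eps < N%:R by apply: archi_boundP; apply: divr_ge0 => //; exact: ltW.
have N0 : (0 : R) < N%:R by apply: lt_trans Neps; rewrite divr_gt0.
have N1 : (1 : R) <= N%:R by rewrite ler1n -(ltr0n R).
have cN : cabs (N%:R : R[i]) = N%:R.
  by rewrite -(rmorph_nat (real_complex R)) cabs_real ger0_norm.
have NC : (N%:R : R[i]) != 0 by rewrite -cabs_gt0 cN.
have [m gm mN] := gaussian_int_round (N%:R * rho).
(* The first two summands absorb [N m - 1 - be e]; the other two are what must remain of |al + be
   e|. *)
pose K := cabs (N%:R * m - 1) + N%:R ^+ 2 + L * (1 + N%:R ^+ 2) + 2 / eps.
pose k := Num.bound K.
have N2 : (1 : R) <= N%:R ^+ 2 by rewrite exprn_ege1.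
have K0 : 0 <= K.
  by rewrite /K !addr_ge0 ?cabs_ge0 ?mulr_ge0 ?addr_ge0 ?invr_ge0 ?sqr_ge0// ltW.
have Kk : K < k%:R by exact: archi_boundP.
have ck : cabs (k%:R : R[i]) = k%:R.
  by rewrite -(rmorph_nat (real_complex R)) cabs_real ger0_norm.
have gN := @gaussian_int_nat R N; have gk := @gaussian_int_nat R k.
have g1 := @gaussian_int1 R.
pose al : R[i] := k%:R * N%:R ^+ 2 - (N%:R * m - 1).
pose be : R[i] := N%:R ^+ 2.
pose de : R[i] := 1 + N%:R * m.
pose ga : R[i] := k%:R * (1 + N%:R * m) - m ^+ 2.
have cbe : cabs be = N%:R ^+ 2 by rewrite /be expr2 cabsM cN expr2.
exists al, be, ga, de, (cabs al + cabs be); split.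
- split; rewrite /al /be /ga /de ?expr2;
    by do ?[apply/gaussian_intB | apply/gaussian_intD | apply/gaussian_intM].
- by rewrite /al /be /ga /de; ring.
move=> e e1.
have w1 : L * (1 + N%:R ^+ 2) + 2 / eps <= cabs (al + be * e).
  have -> : al + be * e = k%:R * N%:R ^+ 2 - (N%:R * m - 1 - be * e).
    by rewrite /al; ring.
  apply: le_trans (cabs_geB _ _).
  have h1 := cabs_leB (N%:R * m - 1) (be * e).
  have h2 : cabs (be * e) <= N%:R ^+ 2.
    by rewrite cabsM cbe ler_piMr// sqr_ge0.
  have h3 : k%:R <= cabs (k%:R * N%:R ^+ 2 : R[i]).
    by rewrite cabsM ck -/be cbe ler_peMr.
  move: Kk; rewrite /K => Kk; lra.
have e2 : 0 < 2 / eps by rewrite divr_gt0.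
have LN : 0 < L * (1 + N%:R ^+ 2) by rewrite mulr_gt0//; lra.
split; first by rewrite cbe; lra.
  apply: (le_trans (cabs_leD _ _)); rewrite cabsM lerD2l.
  by rewrite ler_piMr// cabs_ge0.
have w0' : 0 < cabs (al + be * e) by lra.
have w0 : al + be * e != 0 by rewrite -cabs_gt0.
(* By the determinant, [de / be] exceeds the first ratio by 1 / (be (al + be e)), and [de / be]
   itself is 1 / be + m / N. *)
have -> : (ga + de * e) / (al + be * e) - rho =
    (be^-1 - (be * (al + be * e))^-1) - (N%:R * rho - m) / N%:R.
  move: w0; rewrite /be /de /ga /al => w0; field.
  by rewrite NC /=; apply: contra_neq w0 => <-; ring.
have b1 : cabs (be^-1) <= N%:R^-1.
  rewrite cabsV cbe lef_pV2 ?posrE ?exprn_gt0//.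
  by rewrite expr2 ler_peMr// ltW.
have b2 : cabs ((N%:R * rho - m) / N%:R) <= N%:R^-1.
  by rewrite cabsM cabsV cN ler_piMl ?invr_ge0 ?ltW//; lra.
have b3 : cabs ((be * (al + be * e))^-1) <= eps / 2.
  rewrite cabsV cabsM cbe -[leRHS]invf_div lef_pV2 ?posrE ?mulr_gt0 ?invr_gt0 ?exprn_gt0//.
  have h : cabs (al + be * e) <= N%:R ^+ 2 * cabs (al + be * e).
    by rewrite ler_peMl// cabs_ge0.
  by apply: le_trans h; lra.
have b4 : N%:R^-1 <= eps / 4.
  by rewrite -[leRHS]invf_div lef_pV2 ?posrE ?divr_gt0// ltW.
apply: (le_trans (cabs_leB _ _)).
have := cabs_leB be^-1 (be * (al + be * e))^-1; lra.
Qed.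

End UnimodularRatio.

(** * The critical lattice of the bidisc *)

Section CriticalLattice.
Variable R : realType.

(* With a = crit, the critical lattice for the unit bidisc has basis (1, a) and
   (- i a, 1). *)
Definition crit : R[i] := (1 / 2) +i* (1 - Num.sqrt 3 / 2).

Lemma sqrt3_bounds :
  [/\ Num.sqrt 3 ^+ 2 = 3 :> R, 17 / 10 < Num.sqrt (3 : R) &
      Num.sqrt (3 : R) < 7 / 4].
Proof.
have h : Num.sqrt 3 ^+ 2 = 3 :> R by rewrite sqr_sqrtr.
have := sqrtr_ge0 (3 : R); split => //; nra.
Qed.

Let tau : R := 2 - Num.sqrt 3.

(** For an integer x >= 1, x + tau y < 1 forces y <= -1; then y + tau x >= 0 gives x >= 1 / tau > 3,
    so x + tau y >= (1 - tau^2) x > 1, a contradiction. Hence [a] and [b] are nonpositive, and the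
    lower bounds make them vanish. *)
Lemma int_form_eq0 (a b : int) :
  0 <= a%:~R + tau * b%:~R -> 0 <= b%:~R + tau * a%:~R ->
  a%:~R + tau * b%:~R < 1 -> b%:~R + tau * a%:~R < 1 -> a = 0 /\ b = 0.
Proof.
have [s2 s17 s18] := sqrt3_bounds.
have t0 : 1 / 4 < tau /\ tau < 3 / 10 by rewrite /tau; split; lra.
move: tau t0 => t [t0 t1].
have le0 (x y : int) : 0 <= y%:~R + t * x%:~R -> x%:~R + t * y%:~R < 1 -> x <= 0.
  move=> h1 h2; rewrite leNgt; apply/negP => x0.
  have x1 : (1 : R) <= x%:~R by rewrite (ler_int _ 1).
  have [y0|y0] := leP 0 y.
    have y1 : (0 : R) <= y%:~R by rewrite (ler_int _ 0).
    by nra.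
  have y1 : y%:~R <= (-1 : R).
    by rewrite -[-1]/(-1%:~R) -intrN ler_int; lia.
  by nra.
move=> h1 h2 h3 h4; have a0 := le0 _ _ h2 h3; have b0 := le0 _ _ h1 h4.
have a1 : a%:~R <= (0 : R) by rewrite (ler_int _ _ 0).
have b1 : b%:~R <= (0 : R) by rewrite (ler_int _ _ 0).
have a2 : (a%:~R : R) = 0 by nra.
have b2 : (b%:~R : R) = 0 by nra.
by split; apply/eqP; rewrite -(intr_eq0 R) ?a2 ?b2.
Qed.

(* The two squared coordinates of the lattice point with coefficients m and n are
   A + tau B and B + tau A for the integers A and B below. *)
Lemma crit_admissible (m n : R[i]) : gaussian_int m -> gaussian_int n ->
  cabs (m - n * ('i * crit)) < 1 -> cabs (m * crit + n) < 1 -> m = 0 /\ n = 0.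
Proof.
case: m n => [m1 m2] [n1 n2] [/= /intrP[i1 ->] /intrP[i2 ->]].
move=> [/= /intrP[j1 ->] /intrP[j2 ->]] x1 y1.
have [s2 s17 s18] := sqrt3_bounds.
pose A : int := j1 ^+ 2 + j2 ^+ 2 + (i1 * j1 + i2 * j2).
pose B : int := i1 ^+ 2 + i2 ^+ 2 + (i1 * j2 - i2 * j1).
have yE : cabs ((i1%:~R +i* i2%:~R) * crit + (j1%:~R +i* j2%:~R)) ^+ 2 =
    A%:~R + tau * B%:~R.
  (* [field] treats the square root as an indeterminate, hence the explicit multiple of
     [Num.sqrt 3 ^+ 2 - 3]. *)
  transitivity (A%:~R + tau * B%:~R +
    (i1%:~R ^+ 2 + i2%:~R ^+ 2) / 4 * (Num.sqrt 3 ^+ 2 - 3)).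
    by rewrite sqr_cabs /= /A /B /tau !rmorphE /=; field.
  by rewrite s2 subrr mulr0 addr0.
have xE : cabs ((i1%:~R +i* i2%:~R) - (j1%:~R +i* j2%:~R) * ('i * crit)) ^+ 2 =
    B%:~R + tau * A%:~R.
  transitivity (B%:~R + tau * A%:~R +
    (j1%:~R ^+ 2 + j2%:~R ^+ 2) / 4 * (Num.sqrt 3 ^+ 2 - 3)).
    by rewrite sqr_cabs /= /A /B /tau !rmorphE /=; field.
  by rewrite s2 subrr mulr0 addr0.
have sq1 (z : R[i]) : cabs z < 1 -> cabs z ^+ 2 < 1.
  by move=> z1; rewrite expr_lt1 ?cabs_ge0.
have [A0 B0] : A = 0 /\ B = 0.
  apply: int_form_eq0; rewrite -?yE -?xE ?sqr_ge0//; exact: sq1.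
have : (i1 ^+ 2 + i2 ^+ 2 <= 0) /\ (j1 ^+ 2 + j2 ^+ 2 <= 0).
  move: A0 B0; rewrite /A /B => A0 B0.
  pose X := i1 ^+ 2 + i2 ^+ 2; pose Y := j1 ^+ 2 + j2 ^+ 2.
  (* Here X = |m|^2 and Y = |n|^2, and A = B = 0 says that conj(m) n has real part -Y and imaginary
     part -X. Since X^2 - X Y + Y^2 is positive definite, X and Y vanish. *)
  have : X * Y = X ^+ 2 + Y ^+ 2.
    have -> : X * Y = (i1 * j1 + i2 * j2) ^+ 2 + (i1 * j2 - i2 * j1) ^+ 2.
      by rewrite /X /Y; ring.
    have -> : i1 * j1 + i2 * j2 = - Y by rewrite /Y; lia.
    have -> : i1 * j2 - i2 * j1 = - X by rewrite /X; lia.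
    by ring.
  by rewrite -/X -/Y; move: X Y => X Y h; split; nia.
have sq0 (x y : int) : x ^+ 2 + y ^+ 2 <= 0 -> x = 0 /\ y = 0.
  by move=> ?; split; nia.
by move=> [/sq0[-> ->] /sq0[-> ->]].
Qed.

(** This is the modulus of the determinant of the critical basis. Its inverse, the constant of the
    theorem, is therefore the product of the two scaling factors that lead to covolume 1. *)
Lemma crit_det : cabs (1 + 'i * crit ^+ 2) = (3 - Num.sqrt 3) / Num.sqrt 2 :> R.
Proof.
have [s2 s17 s18] := sqrt3_bounds.
have r0 : 0 < Num.sqrt (2 : R) by rewrite sqrtr_gt0.
apply/eqP; rewrite -(eqrXn2 (n := 2)) ?cabs_ge0//; last first.
  by rewrite divr_ge0 ?ltW// subr_gt0; lra.
rewrite sqr_cabs expr_div_n [Num.sqrt 2 ^+ 2]sqr_sqrtr//=; apply/eqP.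
by move: s2; nra.
Qed.

End CriticalLattice.

(** * Stability of admissibility under perturbation *)

Section Perturbation.
Variable R : realType.

(** Cramer's rule bounds the coefficients of a point of the perturbed lattice in the bidisc by [B],
    uniformly in the perturbation. Returning to the original basis then moves each coordinate by at
    most [2 * B * eps <= h], which the margins [s - 1] and [C' - C] absorb. *)
Lemma admissible_perturb (X1 X2 Y1 Y2 : R[i]) (s C C' : R) :
  1 < s -> 0 <= C < C' -> cabs (X1 * Y2 - X2 * Y1) = 1 ->
  (forall m n, gaussian_int m -> gaussian_int n ->
     cabs (m * X1 + n * X2) < s -> cabs (m * Y1 + n * Y2) < C' ->
     m = 0 /\ n = 0) ->
  exists2 eps, 0 < eps & forall X1' X2' Y1' Y2' m n,
    cabs (X1' - X1) <= eps -> cabs (X2' - X2) <= eps ->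
    cabs (Y1' - Y1) <= eps -> cabs (Y2' - Y2) <= eps ->
    cabs (X1' * Y2' - X2' * Y1') = 1 ->
    gaussian_int m -> gaussian_int n ->
    cabs (m * X1' + n * X2') < 1 -> cabs (m * Y1' + n * Y2') <= C ->
    m = 0 /\ n = 0.
Proof.
move=> s1 /andP[C0 CC'] det adm.
pose S := 1 + cabs X1 + cabs X2 + cabs Y1 + cabs Y2.
have := (cabs_ge0 X1, cabs_ge0 X2, cabs_ge0 Y1, cabs_ge0 Y2).
move=> [[[cX1 cX2] cY1] cY2].
have S1 : 1 <= S by rewrite /S; lra.
pose B := (1 + C) * S.
have B1 : 1 <= B by rewrite /B; nra.
(* The second margin is halved because the bound by [C] is not strict while the bound by [C'] is. *)
pose h := Num.min (s - 1) ((C' - C) / 2).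
have h0 : 0 < h by rewrite lt_min; apply/andP; split; lra.
pose eps := Num.min 1 (h / (2 * B)).
have B0 : 0 < 2 * B by lra.
have eps0 : 0 < eps by rewrite lt_min ltr01 divr_gt0.
have eps1 : eps <= 1 by rewrite ge_min lexx.
have epsB : eps * (2 * B) <= h by rewrite -ler_pdivlMr// ge_min lexx orbT.
exists eps => // X1' X2' Y1' Y2' m n dX1 dX2 dY1 dY2 det' gm gn xlt ylt.
have close (z z' : R[i]) : cabs (z' - z) <= eps -> cabs z' <= 1 + cabs z.
  by move=> dz; rewrite -(subrK z z'); apply: (le_trans (cabs_leD _ _)); lra.
set X := m * X1' + n * X2' in xlt; set Y := m * Y1' + n * Y2' in ylt.
have mB : cabs m <= B.
  rewrite -[cabs m]mulr1 -det' -cabsM.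
  have -> : m * (X1' * Y2' - X2' * Y1') = X * Y2' - Y * X2' by rewrite /X /Y; ring.
  apply: (le_trans (cabs_leB _ _)); rewrite !cabsM.
  have := close _ _ dY2; have := close _ _ dX2.
  have := (cabs_ge0 X2', cabs_ge0 Y2', cabs_ge0 X, cabs_ge0 Y).
  by move=> [[[? ?] ?] ?] ? ?; rewrite /B /S; nra.
have nB : cabs n <= B.
  rewrite -[cabs n]mulr1 -det' -cabsM.
  have -> : n * (X1' * Y2' - X2' * Y1') = Y * X1' - X * Y1' by rewrite /X /Y; ring.
  apply: (le_trans (cabs_leB _ _)); rewrite !cabsM.
  have := close _ _ dY1; have := close _ _ dX1.
  have := (cabs_ge0 X1', cabs_ge0 Y1', cabs_ge0 X, cabs_ge0 Y).
  by move=> [[[? ?] ?] ?] ? ?; rewrite /B /S; nra.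
have diff (u u' v v' : R[i]) : cabs (u' - u) <= eps -> cabs (v' - v) <= eps ->
    cabs (m * u + n * v) <= cabs (m * u' + n * v') + h.
  move=> du dv.
  have -> : m * u + n * v = m * u' + n * v' - (m * (u' - u) + n * (v' - v)) by ring.
  apply: (le_trans (cabs_leB _ _)); rewrite lerD2l.
  apply: (le_trans (cabs_leD _ _)); rewrite !cabsM.
  have := (cabs_ge0 m, cabs_ge0 n, cabs_ge0 (u' - u), cabs_ge0 (v' - v)).
  by move=> [[[? ?] ?] ?]; nra.
have hs : h <= s - 1 by rewrite ge_min lexx.
have hC : h <= (C' - C) / 2 by rewrite ge_min lexx orbT.
apply: adm => //.
  by have := diff _ _ _ _ dX1 dX2; rewrite -/X; lra.
by have := diff _ _ _ _ dY1 dY2; rewrite -/Y; lra.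
Qed.

End Perturbation.

(** * Good discs near rational points *)

Section NearCritical.
Variable R : realType.

Definition inapproximable (C Q : R) (theta : R[i]) :=
  forall p q, gaussian_int p -> gaussian_int q -> 0 < cabs q < Q ->
    C / Q < cabs (q * theta - p).

(** Since [u] has modulus 1, Cramer's rule replaces [(p, q)] by [u] times it, with Gaussian
    coefficients in the given basis. Scaling by [lam] and [mu] turns the system at Q = 1 / |lam|
    into membership in the bidisc. *)
Lemma inapproximable_basis (C : R) (theta lam mu p1 q1 p2 q2 : R[i]) :
  gaussian_int p1 -> gaussian_int q1 ->
  gaussian_int p2 -> gaussian_int q2 ->
  cabs (q2 * p1 - q1 * p2) = 1 -> 0 < cabs lam -> cabs mu = (cabs lam)^-1 ->
  (forall m n, gaussian_int m -> gaussian_int n ->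
    cabs (m * (lam * q1) + n * (lam * q2)) < 1 ->
    cabs (m * (mu * (q1 * theta - p1)) + n * (mu * (q2 * theta - p2))) <= C ->
    m = 0 /\ n = 0) ->
  inapproximable C (cabs lam)^-1 theta.
Proof.
move=> gp1 gq1 gp2 gq2; set u := _ - _ => cu l0 cmu adm p q gp gq /andP[q0 qQ].
rewrite ltNge invrK; apply/negP => small.
have [| | | |m0 n0] := adm (p * q2 - q * p2) (q * p1 - p * q1).
- by apply/gaussian_intB; apply/gaussian_intM.
- by apply/gaussian_intB; apply/gaussian_intM.
- rewrite (_ : _ + _ = lam * (u * q)); last by rewrite /u; ring.
  by rewrite !cabsM cu mul1r mulrC -ltr_pdivlMr// mul1r.
- rewrite (_ : _ + _ = mu * (u * (q * theta - p))); last by rewrite /u; ring.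
  by rewrite !cabsM cu mul1r cmu mulrC ler_pdivrMr.
have : u * q = 0.
  transitivity ((p * q2 - q * p2) * q1 + (q * p1 - p * q1) * q2).
    by rewrite /u; ring.
  by rewrite m0 n0 !mul0r addr0.
by move/eqP; rewrite -cabs_eq0 cabsM cu mul1r gt_eqF.
Qed.

(** The target basis is [(s, Y1)], [(X2, C')]. Normalising by [lam] fixes the first coordinate of
    the first vector, the ratio [q2 / q1] brings that of the second near [X2], and [theta] near [z0]
    brings the third entry near [Y1]. The last entry is then forced by the determinant. *)
Lemma near_critical_disc (C : R) : 0 < C < Num.sqrt 2 / (3 - Num.sqrt 3) ->
  exists2 r, 0 < r <= 1 & forall p q b d : R[i],
    gaussian_int p -> gaussian_int q -> gaussian_int b -> gaussian_int d ->
    cabs (p * d - b * q) = 1 -> q != 0 -> cabs d <= cabs q ->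
    exists2 z0, cabs (z0 - p / q) <= (cabs q ^+ 2)^-1 &
      forall theta, cabs (theta - z0) <= r / cabs q ^+ 2 ->
        exists2 Q, cabs q <= Q & inapproximable C Q theta.
Proof.
set K := _ / _ => /andP[C0 CK].
(* Since s C' = K the scaled critical lattice has covolume 1, with slack in both coordinates. *)
pose C' := (C + K) / 2; pose s := K / C'.
have C'0 : 0 < C' by rewrite /C'; lra.
have CC' : C < C' by rewrite /C'; lra.
have C'K : C' < K by rewrite /C'; lra.
have s1 : 1 < s by rewrite /s ltr_pdivlMr ?mul1r.
have s0 : 0 < s by lra.
have K0 : 0 < K by lra.
have cs : cabs s%:C = s by rewrite cabs_real ger0_norm// ltW.
have cC' : cabs C'%:C = C' by rewrite cabs_real ger0_norm// ltW.
have sC0 : s%:C != 0 by rewrite -cabs_gt0 cs.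
pose X2 : R[i] := - (s%:C * ('i * crit R)); pose Y1 : R[i] := C'%:C * crit R.
pose D := s%:C * C'%:C - X2 * Y1.
have cD : cabs D = 1.
  have -> : D = (s%:C * C'%:C) * (1 + 'i * crit R ^+ 2) by rewrite /D /X2 /Y1; ring.
  have detK : cabs (1 + 'i * crit R ^+ 2) = K^-1 by rewrite crit_det /K invf_div.
  by rewrite !cabsM detK cs cC' /s divfK ?divff ?gt_eqF.
have [||eps eps0 adm] := @admissible_perturb R s%:C X2 Y1 C'%:C s C C' s1 _ cD.
- by rewrite CC' ltW.
- move=> m n gm gn.
  have -> : m * s%:C + n * X2 = s%:C * (m - n * ('i * crit R)) by rewrite /X2; ring.
  have -> : m * Y1 + n * C'%:C = C'%:C * (m * crit R + n) by rewrite /Y1; ring.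
  rewrite !cabsM cs cC' -ltr_pdivlMl// mulVf ?gt_eqF//.
  by rewrite -[_ * _ < C']ltr_pdivlMl// mulVf ?gt_eqF//; exact: crit_admissible.
clearbody X2 Y1.
pose S := cabs X2 + 1 + cabs Y1.
have S0 : 0 < S by rewrite /S; have := cabs_ge0 X2; have := cabs_ge0 Y1; lra.
pose eps1 := Num.min (Num.min eps 1) (eps * s / S).
have e0 : 0 < eps1 by rewrite !lt_min eps0 ltr01 divr_gt0// mulr_gt0.
have e1 : eps1 <= eps by rewrite !ge_min lexx.
have e2 : eps1 <= 1 by rewrite !ge_min lexx orbT.
have e3 : eps1 * S <= eps * s by rewrite -ler_pdivlMr// !ge_min lexx orbT.
(* [L >= s] gives [Q >= |q|]; the other two bounds make each of the two displacements composing
   [z0 - p / q] at most half of |q|^-2. *)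
pose L := 2 + s + 2 * (cabs Y1 * s).
have cY1 := cabs_ge0 Y1.
have Ys : 0 <= cabs Y1 * s by rewrite mulr_ge0// ltW.
have L2 : 2 <= L by rewrite /L; lra.
have L0 : 0 < L by lra.
have Ls : s <= L by rewrite /L; lra.
have LY : 1 + 2 * (cabs Y1 * s) <= L by rewrite /L; lra.
clearbody L.
have [al [be [ga [de [M [[gal gbe gga gde] det H]]]]]] :=
  unimodular_ratio (X2 / s%:C) (divr_gt0 e0 s0) L0.
have cbe := cabs_ge0 be.
have M0 : 0 < M.
  have [|h1 h2 _] := H 0; first by rewrite cabs0.
  apply: lt_le_trans h2; apply: lt_le_trans h1; rewrite mulr_gt0//; lra.
(* Moving [theta] by r / |q|^2 moves [mu * (q1 * theta - p1)] by |w|^2 r / s, where |w| <= M. *)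
pose r := Num.min 1 (eps1 * s / M ^+ 2).
have M2 : 0 < M ^+ 2 by rewrite exprn_gt0.
have r0 : 0 < r.
  by rewrite lt_min ltr01 /=; apply: divr_gt0 => //; exact: mulr_gt0.
have rM : r * M ^+ 2 <= eps1 * s.
  by rewrite -ler_pdivlMr// ge_min lexx orbT.
exists r; first by rewrite r0 ge_min lexx.
move=> p q b d gp gq gb gd u1 q0 dq.
have cq : 0 < cabs q by rewrite cabs_gt0.
have [|wL wM wrho] := H (d / q).
  by rewrite cabsM cabsV ler_pdivrMr// mul1r.
pose w := al + be * (d / q).
rewrite -/w in wL wM wrho.
have Lw : L <= cabs w by apply: le_trans wL; rewrite mulrDr mulr1 lerDl mulr_ge0// ltW.
have cw : 0 < cabs w by exact: lt_le_trans Lw.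
have w0 : w != 0 by rewrite -cabs_gt0.
pose q1 := al * q + be * d; pose p1 := al * p + be * b.
pose q2 := ga * q + de * d; pose p2 := ga * p + de * b.
have q1E : q1 = q * w by rewrite /q1 /w; field.
have cq1 : cabs q1 = cabs q * cabs w by rewrite q1E cabsM.
have q10 : q1 != 0 by rewrite q1E mulf_neq0.
pose u := p * d - b * q.
have uE : q2 * p1 - q1 * p2 = u.
  transitivity ((al * de - be * ga) * u); last by rewrite det mul1r.
  by rewrite /q1 /p1 /q2 /p2 /u; ring.
have u0 : u != 0 by rewrite -cabs_gt0 u1.
pose lam := s%:C / q1; pose mu := D / (u * lam).
have lam0 : lam != 0 by rewrite mulf_neq0 ?invr_neq0.
have clam : cabs lam = s / cabs q1 by rewrite cabsM cabsV cs.
have cmu : cabs mu = (cabs lam)^-1.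
  by rewrite cabsM cabsV cD cabsM u1 !mul1r.
have lmu : lam * mu * u = D by rewrite /mu; field; rewrite u0 lam0.
have lq1 : lam * q1 = s%:C by rewrite /lam divfK.
clearbody mu lam.
have mu0 : mu != 0 by rewrite -cabs_gt0 cmu invr_gt0 cabs_gt0.
(* The solution of [mu * (q1 * z0 - p1) = Y1]. *)
pose z0 := p1 / q1 + Y1 / (mu * q1).
have cq12 : 0 < cabs q1 by rewrite cabs_gt0.
exists z0.
  have -> : z0 - p / q = - (be * u / (q * q1)) + Y1 / (mu * q1).
    rewrite /z0 addrAC; congr (_ + _).
    by move: q10; rewrite /q1 /p1 /u => q10; field; rewrite q10 q0.
  apply: (le_trans (cabs_leD _ _)); rewrite cabsN !cabsM !cabsV !cabsM u1.
  rewrite cmu clam invf_div cq1 mulr1.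
  have h1 : cabs be / (cabs q * (cabs q * cabs w)) <= (cabs q ^+ 2)^-1 / 2.
    have -> : cabs be / (cabs q * (cabs q * cabs w)) =
        (cabs q ^+ 2)^-1 * (cabs be / cabs w).
      by field; rewrite !gt_eqF.
    rewrite ler_wpM2l ?invr_ge0 ?sqr_ge0// ler_pdivrMr//.
    rewrite ler_pdivlMl//; apply: le_trans wL.
    rewrite mulrDr mulr1; apply: le_trans (ler_wpM2r cbe L2) _.
    by rewrite lerDr ltW.
  have h2 : cabs Y1 / (cabs q * cabs w / s * (cabs q * cabs w)) <= (cabs q ^+ 2)^-1 / 2.
    have -> : cabs Y1 / (cabs q * cabs w / s * (cabs q * cabs w)) =
        (cabs q ^+ 2)^-1 * (cabs Y1 * s / cabs w ^+ 2).
      by field; rewrite !gt_eqF.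
    rewrite ler_wpM2l ?invr_ge0 ?sqr_ge0// ler_pdivrMr ?exprn_gt0//.
    have h := le_trans LY Lw; clear - Ys h.
    by rewrite expr2; nra.
  by rewrite [leRHS]splitr; exact: lerD.
move=> theta close.
exists (cabs lam)^-1.
  rewrite clam invf_div cq1 ler_pdivlMr// ler_wpM2l ?cabs_ge0//.
  exact: le_trans Lw.
have gq1 : gaussian_int q1 by apply/gaussian_intD; apply/gaussian_intM.
have gp1 : gaussian_int p1 by apply/gaussian_intD; apply/gaussian_intM.
have gq2 : gaussian_int q2 by apply/gaussian_intD; apply/gaussian_intM.
have gp2 : gaussian_int p2 by apply/gaussian_intD; apply/gaussian_intM.
apply: (@inapproximable_basis C theta lam mu p1 q1 p2 q2) => //.
- by rewrite uE.
- by rewrite cabs_gt0.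
pose Y1' := mu * (q1 * theta - p1); pose X2' := lam * q2.
have dX2 : cabs (X2' - X2) <= eps1.
  have -> : X2' - X2 = s%:C * ((ga + de * (d / q)) / w - X2 / s%:C).
    rewrite /X2' -lq1 q1E /q2; by field; rewrite w0 q0 lam0.
  by rewrite cabsM cs mulrC -ler_pdivlMr.
have dY1 : cabs (Y1' - Y1) <= eps1.
  have -> : Y1' - Y1 = mu * q1 * (theta - z0).
    by rewrite /Y1' /z0; field; rewrite mu0 q10.
  rewrite !cabsM cmu clam invf_div cq1.
  have -> : cabs q * cabs w / s * (cabs q * cabs w) * cabs (theta - z0) =
      cabs w ^+ 2 * (cabs (theta - z0) * cabs q ^+ 2) / s.
    by field; rewrite gt_eqF.
  rewrite ler_pdivrMr//; apply: le_trans rM; rewrite [leRHS]mulrC.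
  apply: ler_pM; rewrite ?mulr_ge0 ?sqr_ge0 ?cabs_ge0//.
    by rewrite lerXn2r// nnegrE ltW.
  by rewrite -ler_pdivlMr// exprn_gt0.
have detD : lam * q1 * (mu * (q2 * theta - p2)) - X2' * Y1' = D.
  transitivity (lam * mu * (q2 * p1 - q1 * p2)); first by rewrite /X2' /Y1'; ring.
  by rewrite uE.
move=> m n gm gn; apply: adm => //.
- by rewrite lq1 subrr cabs0 ltW.
- exact: le_trans dX2 e1.
- exact: le_trans dY1 e1.
- have -> : mu * (q2 * theta - p2) - C'%:C =
     (X2' * (Y1' - Y1) + Y1 * (X2' - X2)) / s%:C.
    apply: (mulfI sC0); rewrite [RHS]mulrC divfK// mulrBr -{1}lq1.
    have -> : s%:C * C'%:C = D + X2 * Y1 by rewrite /D; ring.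
    by rewrite -detD; ring.
  rewrite cabsM cabsV cs ler_pdivrMr//; apply: le_trans e3.
  apply: (le_trans (cabs_leD _ _)).
  rewrite (cabsM X2' (Y1' - Y1)) (cabsM Y1 (X2' - X2)) /S.
  have cX2' : cabs X2' <= cabs X2 + 1.
    rewrite -(subrK X2 X2'); apply: (le_trans (cabs_leD _ _)).
    by rewrite [leRHS]addrC lerD2r; exact: le_trans dX2 e2.
  rewrite mulrDr; apply: lerD; last by rewrite mulrC; apply: ler_wpM2r.
  rewrite [leLHS]mulrC; apply: ler_pM => //; exact: cabs_ge0.
- by rewrite detD.
Qed.

End NearCritical.

(** * Porous sets in the plane *)

Section Squares.
Variable R : realType.
Local Notation plane := (measurableTypeR R * measurableTypeR R)%type.
Local Notation area := ((@lebesgue_measure R \x @lebesgue_measure R)%E).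

(** Sup-norm balls replace discs because the product measure gives their area at once. *)
Definition open_square (c : plane) (r : R) : set plane :=
  @ball R R c.1 r `*` @ball R R c.2 r.

Definition closed_square (c : plane) (r : R) : set plane :=
  @closed_ball R R c.1 r `*` @closed_ball R R c.2 r.

Lemma open_squareP (c z : plane) (r : R) :
  open_square c r z <-> `|(c.1 : R) - z.1| < r /\ `|(c.2 : R) - z.2| < r.
Proof. by []. Qed.

Lemma closed_squareP (c z : plane) (r : R) : 0 < r ->
  closed_square c r z <-> `|(c.1 : R) - z.1| <= r /\ `|(c.2 : R) - z.2| <= r.
Proof. by move=> r0; rewrite /closed_square !closed_ballE. Qed.

Lemma measurable_open_square c r : measurable (open_square c r).
Proof. by apply: measurableX; exact: measurable_ball. Qed.

Lemma measurable_closed_square c r : measurable (closed_square c r).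
Proof. by apply: measurableX; exact: measurable_closed_ball. Qed.

Lemma area_open_square c r : 0 <= r -> area (open_square c r) = (4 * r ^+ 2)%:E.
Proof.
move=> r0; rewrite product_measure1E; [|exact: measurable_ball..].
transitivity ((r *+ 2)%:E * (r *+ 2)%:E)%E.
  by congr mule; exact: lebesgue_measure_ball.
rewrite -EFinM; congr EFin.
by rewrite -mulr_natr; ring.
Qed.

Lemma area_closed_square c r :
  0 <= r -> area (closed_square c r) = (4 * r ^+ 2)%:E.
Proof.
move=> r0; rewrite product_measure1E; [|exact: measurable_closed_ball..].
transitivity ((r *+ 2)%:E * (r *+ 2)%:E)%E.
  by congr mule; exact: lebesgue_measure_closed_ball.
rewrite -EFinM; congr EFin.
by rewrite -mulr_natr; ring.
Qed.

Definition square_open (U : set plane) :=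
  forall z, U z -> exists2 d, 0 < d & open_square z d `<=` U.

Lemma square_openI U V : square_open U -> square_open V -> square_open (U `&` V).
Proof.
move=> oU oV z [/oU[d d0 dU] /oV[e e0 eV]].
exists (Num.min d e); first by rewrite lt_min d0.
move=> w /open_squareP; rewrite !lt_min => -[/andP[? ?] /andP[? ?]].
by split; [apply: dU|apply: eV]; apply/open_squareP.
Qed.

Lemma square_open_bigcup (I : Type) (P : set I) (F : I -> set plane) :
  (forall i, P i -> square_open (F i)) -> square_open (\bigcup_(i in P) F i).
Proof.
move=> oF z [i Pi /(oF i Pi)[d d0 dF]]; exists d => //.
by move=> w /dF; exists i.
Qed.

Lemma square_open_open_square c r : square_open (open_square c r).
Proof.
move=> z /open_squareP[h1 h2].
exists (Num.min (r - `|(c.1 : R) - z.1|) (r - `|(c.2 : R) - z.2|)).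
  by rewrite lt_min !subr_gt0 h1.
move=> w /open_squareP; rewrite !lt_min => -[/andP[a1 _] /andP[_ a2]].
apply/open_squareP; split.
  by have := ler_distD (z.1 : R) c.1 w.1; move: a1; lra.
by have := ler_distD (z.2 : R) c.2 w.2; move: a2; lra.
Qed.

Lemma square_openC_closed_square c r : 0 < r ->
  square_open (~` closed_square c r).
Proof.
move=> r0 z zr.
pose m := Num.max `|(c.1 : R) - z.1| `|(c.2 : R) - z.2|.
have rm : r < m.
  rewrite ltNge; apply/negP; rewrite ge_max => /andP[? ?].
  by apply: zr; apply/closed_squareP.
exists (m - r); first by rewrite subr_gt0.
move=> w /open_squareP[a1 a2] /(closed_squareP _ _ r0)[b1 b2].
have := ler_distD (w.1 : R) c.1 z.1; have := ler_distD (w.2 : R) c.2 z.2.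
rewrite distrC in a1; rewrite distrC in a2.
move=> d1 d2; have : m < m; last by rewrite ltxx.
by rewrite {1}/m gt_max; apply/andP; split; lra.
Qed.

(** * Vitali selection of squares *)

Section Selection.
Variables (I : eqType) (c c' : I -> plane) (r : I -> R) (k : R).
Hypothesis k0 : 0 < k.

Let B i := open_square (c i) (r i).
Let T i := closed_square (c' i) (k * r i).

Lemma exists_max_radius (s : seq I) : s != [::] ->
  exists2 j, j \in s & forall i, i \in s -> r i <= r j.
Proof.
elim: s => // i [|j s] IHs _.
  by exists i; rewrite ?inE// => h; rewrite inE => /eqP->.
have [//|m ms rm] := IHs.
have [im|mi] := leP (r i) (r m).
  exists m; first by rewrite inE ms orbT.
  by move=> h; rewrite inE => /orP[/eqP->//|/rm].
exists i; first by rewrite inE eqxx.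
move=> h; rewrite inE => /orP[/eqP->//|/rm hm]; exact: le_trans hm (ltW mi).
Qed.

Lemma measurable_cover_seq (s : seq I) : measurable (\bigcup_(i in [set` s]) B i).
Proof. by apply: fin_bigcup_measurable => // i _; exact: measurable_open_square. Qed.

(* Greedily choose disjoint squares B j of maximal radius; their triples cover
   the union, and G is the union of the corresponding T j. *)
Lemma vitali_squares (s : seq I) :
  (forall i, i \in s -> 0 < r i /\ T i `<=` B i) ->
  exists G : set plane,
    [/\ measurable G, square_open (~` G), G `<=` \bigcup_(i in [set` s]) B i,
        G `<=` \bigcup_(i in [set` s]) T i &
        ((k ^+ 2 / 9)%:E * area (\bigcup_(i in [set` s]) B i) <= area G)%E].
Proof.
have [n] := ubnP (size s); elim: n s => // n IHn s sn sB.
have [->|s0] := eqVneq s [::].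
  exists set0; split => //.
  - by move=> z _; exists 1 => // w _ [].
  - rewrite (_ : \bigcup_(i in _) _ = set0) ?measure0 ?mule0//.
    by apply/seteqP; split => // z [].
have [j js rj] := exists_max_radius s0.
have [rj0 TBj] := sB j js.
pose s' := [seq i <- s | `[< B i `&` B j = set0 >]].
have cj : B j (c j) by apply/open_squareP; rewrite !subrr normr0.
have s's : {subset s' <= s} by move=> i; rewrite mem_filter => /andP[].
have size_s' : (size s' < n)%N.
  have : (0 < count (predC (fun i => `[< B i `&` B j = set0 >])) s)%N.
    rewrite -has_count; apply/hasP; exists j => //=; apply/asboolP => BB.
    by have : (B j `&` B j) (c j) by []; rewrite BB.
  rewrite size_filter -(ltn_add2l (count (fun i => `[< B i `&` B j = set0 >]) s)).
  rewrite count_predC addn0 => h.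
  by move: sn; rewrite ltnS; exact: leq_trans.
have [|G [mG oG GB GT areaG]] := IHn s' size_s'.
  by move=> i /s's; exact: sB.
exists (G `|` T j); split.
- by apply: measurableU => //; exact: measurable_closed_square.
- rewrite setCU; apply: square_openI => //.
  by apply: square_openC_closed_square; rewrite mulr_gt0.
- move=> z [/GB[i /s's si Bi]|/TBj Bz]; [by exists i|by exists j].
- move=> z [/GT[i /s's si Ti]|Tz]; [by exists i|by exists j].
have mT : measurable (T j) by exact: measurable_closed_square.
have mB3 : measurable (open_square (c j) (3 * r j)) by exact: measurable_open_square.
rewrite measureU//; last first.
  rewrite -subset0 => z [/GB[i /= is' Bi] /TBj Bj].
  move: is'; rewrite mem_filter => /andP[/asboolP ij _].
  by have : (B i `&` B j) z by []; rewrite ij.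
(* A square that meets [B j] has radius at most [r j], so it lies in the triple of [B j]; this is
   the source of the factor 9. *)
have cov : \bigcup_(i in [set` s]) B i `<=`
    (\bigcup_(i in [set` s']) B i) `|` open_square (c j) (3 * r j).
  move=> z [i /= si Biz].
  have [ij|ij] := pselect (B i `&` B j = set0).
    left; exists i => //=; rewrite mem_filter si andbT; exact/asboolP.
  right; move/eqP/set0P: ij => [w [/open_squareP[a1 a2] /open_squareP[b1 b2]]].
  move/open_squareP: Biz => [e1 e2].
  have := rj i si => rij; apply/open_squareP; split.
    rewrite distrC in a1.
    have := ler_distD (w.1 : R) (c j).1 z.1; have := ler_distD ((c i).1 : R) w.1 z.1.
    by lra.
  rewrite distrC in a2.
  have := ler_distD (w.2 : R) (c j).2 z.2; have := ler_distD ((c i).2 : R) w.2 z.2.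
  by lra.
have k9 : (0 <= (k ^+ 2 / 9)%:E)%E by rewrite lee_fin divr_ge0// sqr_ge0.
have le1 : (area (\bigcup_(i in [set` s]) B i) <=
    area (\bigcup_(i in [set` s']) B i) + area (open_square (c j) (3 * r j)))%E.
  have mS := measurable_cover_seq s; have mS' := measurable_cover_seq s'.
  have := le_measure area (mem_set mS) (mem_set (measurableU _ _ mS' mB3)) cov.
  by move=> /le_trans; apply; exact: measureU2.
apply: (le_trans (lee_wpmul2l k9 le1)).
rewrite ge0_muleDr ?measure_ge0//; apply: (leeD areaG).
rewrite -[leRHS]/(area (closed_square (c' j) (k * r j))).
have [rj' k'] := (ltW rj0, ltW k0).
rewrite area_open_square ?area_closed_square ?mulr_ge0//.
by rewrite -EFinM lee_fin le_eqVlt; apply/orP; left; apply/eqP; field.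
Qed.

End Selection.

(** * Uniformly porous sets are null *)

Section Porous.
Variables (I : countType) (c : I -> plane) (r : I -> R) (k : R) (E : set plane).
Hypothesis k01 : 0 < k <= 1.
Hypothesis porous : forall z, E z -> forall d, 0 < d ->
  exists i c', [/\ 0 < r i < d, open_square (c i) (r i) z,
    closed_square c' (k * r i) `<=` open_square (c i) (r i) &
    closed_square c' (k * r i) `<=` ~` E].

Let B i := open_square (c i) (r i).

(** The indexed squares inside [U] with a hole cover [F]. A finite subfamily has half the area of
    their union [W], and its Vitali selection gives holes filling k^2 / 18 of [W]. Removing these
    closed holes keeps openness, so the step can be iterated. *)
Lemma porous_shrink (F U : set plane) : F `<=` E -> F `<=` U ->
  measurable U -> square_open U -> (area U < +oo)%E ->
  exists U', [/\ measurable U', square_open U', F `<=` U', U' `<=` U &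
    (area U' <= (1 - k ^+ 2 / 18)%:E * area U)%E].
Proof.
move=> FE FU mU oU Ufin; have [k0 k1] := andP k01.
pose V i := exists c', [/\ 0 < r i, closed_square c' (k * r i) `<=` B i,
  closed_square c' (k * r i) `<=` ~` E & B i `<=` U].
have /choice[c' c'P] : forall i, exists c', V i ->
    [/\ 0 < r i, closed_square c' (k * r i) `<=` B i,
      closed_square c' (k * r i) `<=` ~` E & B i `<=` U].
  move=> i; have [[c' Vi]|nVi] := pselect (V i); first by exists c'.
  by exists (c i) => /nVi.
pose s n := [seq i <- pmap unpickle (iota 0 n) | `[< V i >]].
have sV n i : i \in s n -> V i by rewrite mem_filter => /andP[/asboolP].
pose W := \bigcup_n \bigcup_(i in [set` s n]) B i.
have ms n : measurable (\bigcup_(i in [set` s n]) B i).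
  exact: measurable_cover_seq.
have mW : measurable W by exact: bigcup_measurable.
have oW : square_open W.
  apply: square_open_bigcup => n _; apply: square_open_bigcup => i _.
  exact: square_open_open_square.
have WU : W `<=` U.
  by move=> z [n _ [i /= /sV Vi Biz]]; have [_ _ _] := c'P i Vi; exact.
have FW : F `<=` W.
  move=> z Fz; have [d d0 dU] := oU z (FU z Fz).
  (* A square of radius below d / 2 containing [z] lies in the square of radius [d] around [z]. *)
  have d20 : 0 < d / 2 by rewrite divr_gt0.
  have [i [b [/andP[ri0 rid] Biz bB bE]]] := porous (FE z Fz) d20.
  have Vi : V i.
    exists b; split => // w /open_squareP[w1 w2]; apply: dU.
    move/open_squareP: Biz => [z1 z2]; apply/open_squareP.
    rewrite distrC in z1; rewrite distrC in z2; split.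
      by have := ler_distD ((c i).1 : R) z.1 w.1; lra.
    by have := ler_distD ((c i).2 : R) z.2 w.2; lra.
  exists (pickle i).+1 => //; exists i => //=.
  rewrite mem_filter; apply/andP; split; first exact/asboolP.
  rewrite mem_pmap; apply/mapP; exists (pickle i); last by rewrite pickleK.
  by rewrite mem_iota leq0n add0n ltnS leqnn.
have Wfin : (area W < +oo)%E.
  by apply: le_lt_trans Ufin; apply: le_measure; rewrite ?inE.
have Wreal : area W \is a fin_num by rewrite ge0_fin_numE.
(* Otherwise continuity from below would bound the finite area of [W] by half of itself, so it would
   be 0 and any [n] would do. *)
have [n Wn] : exists n,
    ((1 / 2)%:E * area W <= area (\bigcup_(i in [set` s n]) B i))%E.
  apply: contrapT => /forallNP small.
  have W2 : (area W <= (1 / 2)%:E * area W)%E.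
    have smono : {homo (fun n => \bigcup_(i in [set` s n]) B i) :
        n m / (n <= m)%N >-> (n <= m)%O}.
      move=> n m nm; apply/subsetPset => z [i /= si Bz]; exists i => //=.
      move: si; rewrite !mem_filter => /andP[-> /=]; rewrite !mem_pmap.
      move=> /mapP[j jn ->]; apply: map_f; move: jn; rewrite !mem_iota !add0n.
      by move=> /andP[-> /= jn]; exact: leq_trans nm.
    have cvgW := nondecreasing_cvg_mu (mu := area) ms mW smono.
    rewrite -[leLHS](cvg_lim _ cvgW)//.
    apply: lime_le; first by apply/cvg_ex; eexists; exact: cvgW.
    by apply: nearW => n; have /negP := small n; rewrite -ltNge => /ltW.
  have W0 : area W = 0%E.
    apply/eqP; rewrite eq_le measure_ge0 andbT.
    move: W2; rewrite -(fineK Wreal) -EFinM !lee_fin; lra.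
  by apply: (small 0%N); rewrite W0 mule0 measure_ge0.
have [|G [mG oG GB GT Gbig]] := @vitali_squares _ c c' r k k0 (s n).
  by move=> i /sV /c'P[].
have GW : G `<=` W by move=> z /GB Bz; exists n.
have Gfin : (area G < +oo)%E.
  by apply: le_lt_trans Wfin; apply: le_measure; rewrite ?inE.
exists (W `\` G); split.
- exact: measurableD.
- by rewrite setDE; exact: square_openI.
- move=> z Fz; split; first exact: FW.
  move=> /GT[i /= /sV /c'P[_ _ TE _]] Tz; exact: TE Tz (FE z Fz).
- by move=> z [/WU].
have -> : area (W `\` G) = (area W - area G)%E.
  by rewrite measureD// setIidr.
have Greal : area G \is a fin_num by rewrite ge0_fin_numE.
have Ureal : area U \is a fin_num by rewrite ge0_fin_numE ?measure_ge0.
have WleU : (area W <= area U)%E by apply: le_measure; rewrite ?inE.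
have k9 : (0 <= (k ^+ 2 / 9)%:E)%E by rewrite lee_fin divr_ge0// sqr_ge0.
have := le_trans (lee_wpmul2l k9 Wn) Gbig.
rewrite -(fineK Wreal) -(fineK Greal) -(fineK Ureal) in WleU *.
rewrite -!EFinM -EFinB !lee_fin in WleU * => h.
have W0 : 0 <= fine (area W) by rewrite fine_ge0 ?measure_ge0.
move: (fine (area W)) (fine (area G)) (fine (area U)) h WleU W0 => w g u h wu w0.
have kk : 0 <= 1 - k ^+ 2 / 18 by nra.
apply: le_trans (ler_wpM2l kk wu); lra.
Qed.

(** Cutting [E] into bounded pieces gives a start of finite area; iterated shrinking then yields
    measurable covers whose areas decay geometrically. *)
Lemma porous_negligible : area.-negligible E.
Proof.
have [k0 k1] := andP k01.
have -> : E = \bigcup_n (E `&` open_square (0, 0) n%:R).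
  apply/seteqP; split => [z Ez|z [n _ []]//].
  exists (Num.bound (`|(z.1 : R)| + `|(z.2 : R)|)) => //; split => //.
  have := archi_boundP (addr_ge0 (normr_ge0 (z.1 : R)) (normr_ge0 (z.2 : R))).
  by move=> h; apply/open_squareP; rewrite /= !sub0r !normrN; split;
    have := normr_ge0 (z.1 : R); have := normr_ge0 (z.2 : R); lra.
apply: negligible_bigcup => N; set F := E `&` _.
pose q := 1 - k ^+ 2 / 18; pose M : R := 4 * N%:R ^+ 2.
have q01 : 0 <= q < 1 by rewrite /q; apply/andP; split; nra.
have [q0 q1] := andP q01.
have shrunk n : exists U, [/\ measurable U, square_open U, F `<=` U &
    (area U <= (q ^+ n * M)%:E)%E].
  elim: n => [|n [U [mU oU FU aU]]].
    exists (open_square (0, 0) N%:R); split.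
    - exact: measurable_open_square.
    - exact: square_open_open_square.
    - by move=> z [].
    - by rewrite area_open_square ?expr0 ?mul1r.
  have [|U' [mU' oU' FU' _ aU']] := porous_shrink (@subIsetl _ _ _) FU mU oU.
    by apply: le_lt_trans aU _; rewrite ltry.
  exists U'; split => //; apply: (le_trans aU').
  have q0E : (0 <= q%:E)%E by rewrite lee_fin.
  have -> : q ^+ n.+1 * M = q * (q ^+ n * M) by rewrite exprS mulrA.
  by rewrite EFinM; exact: (lee_wpmul2l q0E aU).
have [U UP] := choice shrunk.
have mU n : measurable (U n) by have [] := UP n.
exists (\bigcap_n U n); split.
- exact: bigcap_measurable.
- have Un n : (area (\bigcap_n U n) <= (q ^+ n * M)%:E)%E.
    have [_ _ _] := UP n; apply: le_trans; apply: le_measure; rewrite ?inE//.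
      exact: bigcap_measurable.
    by move=> z; exact.
  have real : area (\bigcap_n U n) \is a fin_num.
    by rewrite ge0_fin_numE//; apply: le_lt_trans (Un 0%N) _; rewrite ltry.
  suff U0 : (area (\bigcap_n U n) <= 0)%E.
    by apply/eqP; rewrite eq_le measure_ge0 andbT.
  rewrite -(fineK real) lee_fin.
  have cvg0 : (q ^+ n * M) @[n --> \oo] --> (0 : R).
    by rewrite -[0](mul0r M); apply: cvgMl; apply: cvg_expr; rewrite ger0_norm.
  rewrite -(cvg_lim _ cvg0)//; apply: limr_ge; first by apply/cvg_ex; exists 0.
  by apply: nearW => n; have := Un n; rewrite -{1}(fineK real) lee_fin.
- by move=> z Fz n _; have [_ _ FU _] := UP n; exact: FU.
Qed.

End Porous.
End Squares.

(** * Null sets of bad points *)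

Section BadSets.
Variable R : realType.
Local Notation plane := (measurableTypeR R * measurableTypeR R)%type.
Local Notation area := ((@lebesgue_measure R \x @lebesgue_measure R)%E).

Definition gaussian_irrational (theta : R[i]) :=
  forall p q, gaussian_int p -> gaussian_int q -> q != 0 -> q * theta - p != 0.

(** A quotient of Gaussian integers has rational real part, so these points lie on countably many
    vertical lines. *)
Lemma negligible_gaussian_rational :
  area.-negligible [set z : plane | ~ gaussian_irrational (z.1 +i* z.2)].
Proof.
pose Q : set (measurableTypeR R) := range (@ratr R).
have mQ : measurable Q.
  apply: countable_measurable; first by move=> t; exact: measurable_set1.
  by apply: card_le_trans (card_image_le _ _) _; exact: countableP.
exists (Q `*` setT); split.
- by apply: measurableX.
- rewrite product_measure1E//.
  transitivity (0 * @lebesgue_measure R setT)%E; last by rewrite mul0e.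
  by congr mule; exact: lebesgue_measure_rat.
move=> [x y] /= notirr; split => //=; apply: contrapT => xQ; apply: notirr.
move=> [p1 p2] [q1 q2] [/= /intrP[a ->] /intrP[b ->]] [/= /intrP[c ->] /intrP[d ->]].
move=> q0; apply/eqP => /eqP; rewrite subr_eq0 eq_complex /= => /andP[/eqP e1 /eqP e2].
apply: xQ; exists ((a * c + b * d)%:~R / (c ^+ 2 + d ^+ 2)%:~R) => //.
have n0 : c%:~R ^+ 2 + d%:~R ^+ 2 != 0 :> R.
  apply: contraNneq q0; move/eqP; rewrite paddr_eq0 ?sqr_ge0// !sqrf_eq0.
  by move=> /andP[/eqP c0 /eqP d0]; rewrite eq_complex /= c0 d0 eqxx.
rewrite fmorph_div /= !ratr_int !rmorphE /=.
apply: (canLR (mulfK n0)); rewrite !intrM -e1 -e2; ring.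
Qed.

(** In units of |q|^-2, the point is within 3 of [p / q], and the good disc has its centre within 1
    and radius [r <= 1]. The square of half-side 4 thus contains both, and the closed square of
    half-side r / 2 about [z0] lies in the good disc. *)
Lemma negligible_dirichlet_improvable (C T : R) :
  0 < C < Num.sqrt 2 / (3 - Num.sqrt 3) -> 0 < T ->
  area.-negligible [set z : plane | gaussian_irrational (z.1 +i* z.2) /\
    forall Q, T <= Q -> ~ inapproximable C Q (z.1 +i* z.2)].
Proof.
move=> /near_critical_disc[r /andP[r0 r1] disc] T0.
pose cint (a : int * int) : R[i] := a.1%:~R +i* a.2%:~R.
have cintP (z : R[i]) : gaussian_int z -> exists a, z = cint a.
  by case: z => x y [/= /intrP[a ->] /intrP[b ->]]; exists (a, b).
pose ctr (i : (int * int) * (int * int)) : plane :=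
  (complex.Re (cint i.1 / cint i.2), complex.Im (cint i.1 / cint i.2)).
(* A zero denominator yields radius 0, which excludes that index from the coverings. *)
pose rad (i : (int * int) * (int * int)) : R := 4 / cabs (cint i.2) ^+ 2.
apply: (@porous_negligible R _ ctr rad (r / 8)).
  by apply/andP; split; lra.
move=> [x y] [/= irr _] dl dl0.
(* [T] is for the bound on [Q]; the rest gives |q|^2 > |q| > 4 / dl, so the radius is below [dl]. *)
pose H := T + 1 + 4 / dl.
have dl4 : 0 < 4 / dl by rewrite divr_gt0.
have H0 : 0 < H by rewrite /H; lra.
have [p [q [b [d [[gp gq gb gd] det Hq dq approx]]]]] := dirichlet_unimodular H0 irr.
have q0 : q != 0 by rewrite -cabs_gt0; lra.
have [z0 z0pq z0disc] := disc p q b d gp gq gb gd det q0 dq.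
have [a pa] := cintP p gp; have [a' qa] := cintP q gq.
have q2 : 0 < cabs q ^+ 2 by rewrite exprn_gt0// cabs_gt0.
pose S := (cabs q ^+ 2)^-1; have S0 : 0 < S by rewrite invr_gt0.
have radE : rad (a, a') = 4 * S by rewrite /rad /S qa.
have kradE : r / 8 * rad (a, a') = r * S / 2 by rewrite radE; lra.
have krad0 : 0 < r / 8 * rad (a, a') by rewrite kradE divr_gt0// mulr_gt0.
have rS : r * S <= S by rewrite ler_piMl// ltW.
have ctrE : ctr (a, a') = (complex.Re (p / q), complex.Im (p / q)) by rewrite pa qa.
have near_pq (z : R[i]) (rho : R) : cabs (p / q - z) < rho ->
    open_square (ctr (a, a')) rho (complex.Re z, complex.Im z).
  move=> hz; apply/open_squareP; rewrite ctrE /=.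
  have := cabs_geRe (p / q - z); have := cabs_geIm (p / q - z).
  by rewrite !raddfB /=; split; lra.
exists (a, a'), (complex.Re z0, complex.Im z0); split.
- rewrite radE mulr_gt0//= /S ltr_pdivrMr// mulrC -ltr_pdivrMr//.
  have h : 4 / dl < cabs q by move: Hq; rewrite /H; lra.
  have h1 : 1 < cabs q by move: Hq; rewrite /H; lra.
  by apply: (lt_trans h); rewrite expr2; nra.
- rewrite radE; apply: (near_pq (x +i* y)).
  have -> : p / q - (x +i* y) = - ((q * (x +i* y) - p) / q) by field.
  rewrite cabsN cabsM cabsV.
  have -> : cabs (q * (x +i* y) - p) / cabs q =
      cabs q * cabs (q * (x +i* y) - p) * S.
    by rewrite /S; field; rewrite gt_eqF// cabs_gt0.
  by apply: (le_lt_trans (ler_wpM2r (ltW S0) approx)); lra.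
- move=> [u v] /closed_squareP-/(_ krad0) []; rewrite kradE /= => hu hv.
  rewrite radE; apply: (near_pq (u +i* v)).
  have -> : p / q - (u +i* v) = (z0 - (u +i* v)) - (z0 - p / q) by ring.
  apply: (le_lt_trans (cabs_leB _ _)).
  have := cabs_leReIm (z0 - (u +i* v)); rewrite !raddfB /=.
  by move: z0pq; rewrite -/S; lra.
- move=> [u v] /closed_squareP-/(_ krad0) []; rewrite kradE /= => hu hv [_ bad].
  have [|Q qQ] := z0disc (u +i* v).
    rewrite cabs_distC; apply: (le_trans (cabs_leReIm _)); rewrite !raddfB /=.
    by rewrite -/S; lra.
  by apply: bad; apply: le_trans qQ; move: Hq; rewrite /H; lra.
Qed.

End BadSets.

(** * Countable union over constants and thresholds *)

Unset Implicit Arguments.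
Set Strict Implicit.

Theorem theorem5 (R : realType) :
  ae_complex (fun theta : R[i] =>
    forall C T : R,
      C < Num.sqrt 2 / (3 - Num.sqrt 3) -> 1 <= T ->
      exists Q : R, T <= Q /\
        ~ (exists p q : R[i],
             [/\ gaussian_int p, gaussian_int q,
                 0 < `|q| < Q%:C
               & `|q * theta - p| <= (C / Q)%:C])).
Proof.
set K : R := _ / _.
have K0 : 0 < K.
  have [_ _ s] := sqrt3_bounds R.
  by rewrite divr_gt0 ?sqrtr_gt0// subr_gt0; lra.
(* A sequence tending to [K] from below, so countably many bad sets suffice; the shift by 2 keeps
   [c 0] positive. *)
pose c n : R := K * (1 - n.+2%:R^-1).
have n2 n : 0 < n.+2%:R^-1 :> R by rewrite invr_gt0 ltr0n.
have cK n : 0 < c n < K.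
  have n1 : n.+2%:R^-1 < 1 :> R by rewrite invf_lt1 ?ltr0n// ltr1n.
  by rewrite /c mulr_gt0 ?subr_gt0//= gtr_pMr// gtrBl.
pose bad n t := [set z : R * R | gaussian_irrational (z.1 +i* z.2) /\
    forall Q, t.+1%:R <= Q -> ~ inapproximable (c n) Q (z.1 +i* z.2)].
have := negligibleU (negligible_gaussian_rational R)
  (negligible_bigcup (fun n => negligible_bigcup (fun t =>
     negligible_dirichlet_improvable (cK n) (ltr0Sn R t)))).
apply: negligibleS => z /= notP.
have [irr|] := pselect (gaussian_irrational (z.1 +i* z.2)); last by left.
right; apply: contrapT => notbad; apply: notP => C T CK T1.
have [n Cn] : exists n, C <= c n.
  (* [C <= c n] amounts to K / (n + 2) <= K - C. *)
  pose n := Num.bound (K / (K - C)); exists n.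
  have h : K / (K - C) < n%:R.
    by apply: archi_boundP; rewrite divr_ge0// ltW// subr_gt0.
  rewrite /c mulrBr mulr1 lerBrDr -lerBrDl ler_pdivrMr ?ltr0n//.
  rewrite mulrC -ler_pdivrMr ?subr_gt0//; apply: le_trans (ltW h) _.
  by rewrite ler_nat ltnW.
pose t := Num.bound T.
have Tt : T <= t.+1%:R.
  have := archi_boundP (le_trans ler01 T1); rewrite -/t => /ltW h.
  by apply: (le_trans h); rewrite ler_nat.
have : ~ bad n t z by move=> Bz; apply: notbad; exists n => //; exists t.
move=> /not_andP[//|/existsNP[Q /not_implyP[tQ /contrapT good]]].
have TQ : T <= Q by exact: le_trans tQ.
exists Q; split => // -[p [q [gp gq q0Q small]]].
have normE (w : R[i]) : `|w| = (cabs w)%:C by case: w.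
have Q0 : 0 < Q by lra.
move: q0Q small; rewrite !normE !ltcR lecR => q0Q small.
have := good p q gp gq q0Q; apply/negP.
by rewrite -leNgt (le_trans small)// ler_pM2r ?invr_gt0.
Qed.
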